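(* Let $\sigma\ge 2$ and let $\Sigma$ be an alphabet of size $\sigma$. There exists an infinite family of rooted, ordered trees with node labels from $\Sigma$ (with the number of nodes $n$ unbounded over the family) such that, for every tree in the family, the top DAG produced by the top tree construction algorithm of Bille et al. described in the context has $\Omega\!\left(\frac{n}{\log_\sigma n}\log\log_\sigma n\right)$ nodes.
   Context: Trees are rooted and ordered (children of each node ordered left to right); every node carries a label from $\Sigma$. For a node $v$ with children $v_1,\dots,v_k$, $T(v)$ is the subtree rooted at $v$, $F(v)=T(v_1)\cup\dots\cup T(v_k)$, and for $1\le s\le r\le k$, $T(v,v_s,v_r)=\{v\}\cup T(v_s)\cup\dots\cup T(v_r)$. A cluster is either of the form $T(v,v_s,v_r)$ (top boundary node $v$) or $T(v,v_s,v_r)\setminus F(u)$ for a node $u\in T(v,v_s,v_r)\setminus\{v\}$ (top boundary node $v$, bottom boundary node $u$). Two edge-disjoint clusters sharing exactly one boundary node whose union is a cluster can be merged into that union; there are five possible configurations (types) of such a merge. A top tree of $T$ is an ordered labeled binary tree whose nodes are clusters: the root is $T$, the leaves are the single edges of $T$ (a leaf for edge $(u,v)$ with $u$ the parent is labeled by the pair (label of $u$, label of $v$)), and each internal node is the merge of its two children, labeled by the type of merge (one of 5 labels), with the left child being the cluster visited first in a preorder traversal of $T$. The algorithm of Bille et al. builds the top tree bottom-up. It maintains an ordered tree $\widetilde T$, initially $T$, whose edges correspond to the current clusters (initially the edges of $T$); merging two edges of $\widetilde T$ means merging the corresponding clusters and replacing the two edges by a single edge of $\widetilde T$ (for a vertical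 merge of $(v_1,v_2),(v_2,v_3)$ the node $v_2$ disappears and the new edge is $(v_1,v_3)$; for a horizontal merge of two sibling edges below $v$, at least one of which goes to a leaf, the new edge goes from $v$ to the other child, the leaf disappearing). The algorithm repeats iterations until a single cluster remains; each iteration consists of: (1) Horizontal merges: for each node $v$ of $\widetilde T$ with $k\ge2$ children $v_1,\dots,v_k$, for $i=1,\dots,\lfloor k/2\rfloor$ merge edges $(v,v_{2i-1})$ and $(v,v_{2i})$ if $v_{2i-1}$ or $v_{2i}$ is a leaf; if $k$ is odd, $v_k$ is a leaf and both $v_{k-2},v_{k-1}$ are non-leaves, also merge $(v,v_{k-1})$ and $(v,v_k)$. (2) Vertical merges: for each maximal path $v_1,\dots,v_p$ in $\widetilde T$ with $v_{i+1}$ the parent of $v_i$ and $v_2,\dots,v_{p-1}$ each having a single child: if $p$ is even merge the pairs $\{(v_1,v_2),(v_2,v_3)\},\dots,\{(v_{p-3},v_{p-2}),(v_{p-2},v_{p-1})\}$; if $p$ is odd merge the pairs $\{(v_1,v_2),(v_2,v_3)\},\dots,\{(v_{p-4},v_{p-3}),(v_{p-3},v_{p-2})\}$, and if $(v_{p-1},v_p)$ was not merged in the horizontal step also merge $\{(v_{p-2},v_{p-1}),(v_{p-1},v_p)\}$. The top DAG is the minimal DAG representation of the resulting top tree, obtained by identifying identical (isomorphic as ordered labeled trees) subtrees; its size is its number of nodes. *)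

(* Defs.v *)
From HB Require Import structures.
From mathcomp Require Import all_boot all_order all_algebra.
From mathcomp Require Import reals exp.
Set Implicit Arguments.
Unset Strict Implicit.
Unset Printing Implicit Defensive.
Import Order.TTheory GRing.Theory Num.Theory.

Inductive tree (A : Type) := Node of A & seq (tree A).

Definition label (A : Type) (t : tree A) : A := let: Node a _ := t in a.

Fixpoint nodes (A : Type) (t : tree A) : nat :=
  let: Node _ ts := t in (sumn (map (@nodes A) ts)).+1.

(* The five configurations of a merge.  They are told apart by the direction of
   the merge and by which clusters have a bottom boundary node:
   - vertical: the lower cluster has one ([VBottom]) or not ([VNoBottom]);
   - horizontal: the left one has one ([HLeft]), the right one has one
     ([HRight]), or neither has one ([HNone]). *)
Variant merge_type := VBottom | VNoBottom | HLeft | HRight | HNone.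

(* Isomorphism of ordered labelled binary trees is Leibniz equality on this
   type.  Clusters are not stored: a cluster is determined by the leaves below
   it, i.e. by the edges of the input tree that it contains. *)
Inductive top_tree (A : Type) :=
  | TLeaf of A & A
  | TMerge of merge_type & top_tree A & top_tree A.

Definition merge_code (m : merge_type) : nat :=
  match m with
  | VBottom => 0 | VNoBottom => 1 | HLeft => 2 | HRight => 3 | HNone => 4
  end.

Definition merge_decode (n : nat) : merge_type :=
  match n with
  | 0 => VBottom | 1 => VNoBottom | 2 => HLeft | 3 => HRight | _ => HNone
  end.

Fixpoint top_code (A : Type) (t : top_tree A) : GenTree.tree (A * A) :=
  match t with
  | TLeaf a b => GenTree.Leaf (a, b)
  | TMerge m l r => GenTree.Node (merge_code m) [:: top_code l; top_code r]
  end.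

Fixpoint top_decode (A : Type) (g : GenTree.tree (A * A)) :
    option (top_tree A) :=
  match g with
  | GenTree.Leaf (a, b) => Some (TLeaf a b)
  | GenTree.Node n [:: l; r] =>
      if top_decode l is Some l' then
        if top_decode r is Some r' then Some (TMerge (merge_decode n) l' r')
        else None
      else None
  | _ => None
  end.

Lemma top_codeK (A : Type) : pcancel (@top_code A) (@top_decode A).
Proof. by elim=> //= m l -> r ->; case: m. Qed.

HB.instance Definition _ (A : eqType) :=
  Equality.copy (top_tree A) (pcan_type (@top_codeK A)).

Fixpoint subtrees (A : Type) (t : top_tree A) : seq (top_tree A) :=
  t :: (if t is TMerge _ l r then subtrees l ++ subtrees r else [::]).

(* Number of nodes of the minimal DAG: one node per distinct subtree. *)
Definition top_dag_size (A : eqType) (t : top_tree A) : nat :=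
  size (undup (subtrees t)).

(* Ordered trees with data on the edges: [ENode [:: (e1, t1); ...; (ek, tk)]]
   is a node whose i-th child is the root of [ti], reached by the edge [ei]. *)
Inductive etree (E : Type) := ENode of seq (E * etree E).

Definition kids (E : Type) (t : etree E) : seq (E * etree E) :=
  let: ENode cs := t in cs.

Definition is_leaf (E : Type) (t : etree E) : bool := nilp (kids t).

Fixpoint init (A : Type) (t : tree A) : etree (top_tree A) :=
  let: Node a ts := t in
  ENode (map (fun s => (TLeaf a (label s), init s)) ts).

(* Every edge of the auxiliary tree carries the part of the top tree built so
   far for its cluster.  That cluster has a bottom boundary node exactly when
   the edge does not end in a leaf of the auxiliary tree.  During an iteration
   edges also carry a boolean: [true] for the result of a horizontal merge of
   this iteration. *)

Definition htype (left_leaf right_leaf : bool) : merge_type :=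
  if left_leaf then (if right_leaf then HNone else HRight) else HLeft.

Section Iteration.
Variable A : Type.
Local Notation top := (top_tree A).
Local Notation marked := (bool * top_tree A)%type.

Definition hmerge (x y : top * etree marked) : marked * etree marked :=
  ((true, TMerge (htype (is_leaf x.2) (is_leaf y.2)) x.1 y.1),
   if is_leaf x.2 then y.2 else x.2).

Definition hkeep (x : top * etree marked) : marked * etree marked :=
  ((false, x.1), x.2).

(* The case of exactly three remaining children is the end of a list of odd
   length: there the last child may be merged with the one before it. *)
Fixpoint hmerges (cs : seq (top * etree marked)) :
    seq (marked * etree marked) :=
  match cs with
  | [:: x; y; z] =>
      if is_leaf x.2 || is_leaf y.2 then [:: hmerge x y; hkeep z]
      else if is_leaf z.2 then [:: hkeep x; hmerge y z]
      else [:: hkeep x; hkeep y; hkeep z]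
  | x :: y :: cs' =>
      if is_leaf x.2 || is_leaf y.2 then hmerge x y :: hmerges cs'
      else [:: hkeep x, hkeep y & hmerges cs']
  | _ => map hkeep cs
  end.

Fixpoint hstep (t : etree top) : etree marked :=
  let: ENode cs := t in ENode (hmerges (map (fun c => (c.1, hstep c.2)) cs)).

(* [s] lists the edges of a maximal path v_1, ..., v_p from the bottom edge
   (v_1, v_2) to the top edge (v_{p-1}, v_p), and [lf] tells whether the lower
   end of the first edge of [s] is a leaf.  Only the top edge may be marked.  If
   p is even, the number of edges is odd and the top edge stays unpaired. *)
Fixpoint vmerges (lf : bool) (s : seq marked) : seq top :=
  match s with
  | x :: y :: s' =>
      if y.1 then map snd s
      else TMerge (if lf then VNoBottom else VBottom) y.2 x.2
             :: vmerges false s'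
  | _ => map snd s
  end.

(* The tree obtained by hanging [u] below the path [s] after merging in [s]. *)
Definition vpath (p : seq marked * etree top) : etree top :=
  let: (s, u) := p in
  foldl (fun u' x => ENode [:: (x, u')]) u (vmerges (is_leaf u) s).

(* For a node [t]: the edges, from bottom to top, of the path going down from
   [t] through nodes having a single child, and the processed tree rooted at the
   lower end of that path.  "Single child" refers to the auxiliary tree as it is
   at the beginning of the iteration; in the tree left by the horizontal merges
   this means that the only child edge is unmarked, since a node that had
   several children and has just one left has a marked child edge. *)
Fixpoint vdown (t : etree marked) : seq marked * etree top :=
  let: ENode cs := t in
  match cs with
  | [:: ((false, x), t')] =>
      let: (s, u) := vdown t' in (rcons s (false, x), u)
  | _ =>
      ([::], ENode (flatten (map (fun c =>
         let: (s, u) := vdown c.2 in kids (vpath (rcons s c.1, u))) cs)))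
  end.

Definition vstep (t : etree marked) : etree top := vpath (vdown t).

Definition iteration (t : etree top) : etree top := vstep (hstep t).

(* Iterating leaves a tree with a single edge unchanged, so this determines
   [c] uniquely. *)
Definition top_tree_of (T : tree A) (c : top) : Prop :=
  exists k : nat, iter k iteration (init T) = ENode [:: (c, ENode [::])].

End Iteration.

Local Open Scope ring_scope.

Definition log_base (R : realType) (b x : R) : R := ln x / ln b.

(* Main.v *)
Require Import Defs.
From mathcomp Require Import all_boot all_order all_algebra.
From mathcomp Require Import reals exp.
From mathcomp Require Import zify lra.
Import Order.TTheory GRing.Theory Num.Theory.

(* A star with m = 4^p leaves collapses to a single edge in log_2 m = 2p
   iterations, but a complete binary tree loses only one level per two
   iterations, so that one with Theta(m) edges survives for about 2 log_2 m
   iterations.  Hang a star, whose leaves are labelled with a word w of length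
   m, from the leftmost bottom node of a complete binary tree of height 2p + 1
   with constant labels.  After 2p iterations the star is one cluster that
   determines w, while p + 1 levels of the binary tree are left; from then on
   every second iteration merges the cluster determining w with a part of the
   binary tree, which gives at least p + 1 distinct clusters determining w.
   Putting the K = sigma^m such gadgets, one for each word w, below a common
   root gives n < 5 m K nodes and at least (p + 1) K nodes in the top DAG, where
   log_sigma n = Theta(m) and p = Theta(log m). *)

Set Implicit Arguments.
Unset Strict Implicit.
Unset Printing Implicit Defensive.

(** * Iterations seen from a single node *)

Section Construction.
Variables (A : Type) (a : A).
Local Notation top := (top_tree A).
Local Notation leaf := (@ENode _ nil).
Local Notation e := (TLeaf a a).

(** An enclosing vertical step sees [t] only through this pair: a path to be continued upwards and
    the tree hanging below it. *)
Definition down (t : etree top) := vdown (hstep t).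
Definition next (t : etree top) : etree top := (down t).2.
(* At such a node every path of the vertical step that comes from above ends, so
   the subtree is processed independently of its surroundings. *)
Definition branching (t : etree top) := ~~ is_leaf t && nilp (down t).1.

Lemma branchingP t u : ~~ is_leaf t -> down t = ([::], u) ->
  branching t /\ next t = u.
Proof. by rewrite /branching /next => -> ->. Qed.

Lemma down_branching t : branching t -> down t = ([::], next t).
Proof. by rewrite /next; case/andP=> _; case: (down t) => s u /nilP /= ->. Qed.

Lemma branching_nonleaf t : branching t -> ~~ is_leaf t.
Proof. by case/andP. Qed.

Lemma is_leaf_hstep (t : etree top) : is_leaf (hstep t) = is_leaf t.
Proof. by case: t => -[|x [|y [|z [|u s]]]] //=; do !case: ifP. Qed.

Lemma hmerges_nonleaf (cs : seq (top * etree (bool * top))) :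
  all (fun c => ~~ is_leaf c.2) cs -> hmerges cs = map (@hkeep A) cs.
Proof.
have [n] := ubnP (size cs); elim: n cs => // n IH [|x [|y [|z [|u s]]]] //.
- by move=> _ /= /and3P[/negPf -> /negPf ->].
- by move=> _ /= /and4P[/negPf -> /negPf -> /negPf ->].
move=> sz /and3P[/negPf hx /negPf hy hs].
rewrite [LHS]/= hx hy /=; congr [:: _, _ & _]; apply: (IH [:: z, u & s]) => //.
by move: sz => /=; lia.
Qed.

(** Without a leaf among the children nothing merges horizontally at the top node, and with two
    children or more it ends all paths from below. *)
Lemma down_nonleaf (ts : seq (top * etree top)) :
  1 < size ts -> all (fun c => ~~ is_leaf c.2) ts ->
  down (ENode ts) = ([::], ENode (flatten [seq
    kids (vpath (rcons (down c.2).1 (false, c.1), (down c.2).2)) | c <- ts])).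
Proof.
move=> sz nl; rewrite /down /= hmerges_nonleaf; last first.
  by rewrite all_map; apply: sub_all nl => c /=; rewrite is_leaf_hstep.
case: ts sz nl => [|x [|y s]] // _ _ /=.
rewrite -!map_comp; do 2!case: (vdown _) => ? ?; congr (_, ENode (_ ++ (_ ++ flatten _))).
by apply: eq_map => c /=; case: (vdown _).
Qed.

Definition pair_node (x y : top * etree top) := ENode [:: x; y].

Lemma pair_branching x t y u : branching t -> branching u ->
  branching (pair_node (x, t) (y, u)) /\
  next (pair_node (x, t) (y, u)) = pair_node (x, next t) (y, next u).
Proof.
move=> bt bu; apply: branchingP => //.
rewrite down_nonleaf //=; first by rewrite !down_branching.
by rewrite !branching_nonleaf.
Qed.

(** * The slowly contracting part *)

Definition single x := ENode [:: (x, leaf)] : etree top.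
Definition cherry x := pair_node (x, leaf) (x, leaf).
Definition full n t : etree top := iter n (fun u => pair_node (e, u) (e, u)) t.

Lemma fullSr n t : full n.+1 t = full n (full 1 t).
Proof. exact: iterSr. Qed.

Lemma full_branching n t : branching t ->
  branching (full n t) /\ next (full n t) = full n (next t).
Proof.
move=> bt; elim: n => [|n [IHb IHn]] //=.
by have [-> ->] := @pair_branching e (full n t) e (full n t) IHb IHb; rewrite IHn.
Qed.

(* The effect of two iterations on the bottom edges of a complete binary tree
   all of whose other edges are [e]. *)
Definition grow x := TMerge VNoBottom e (TMerge HNone x x).

Lemma cherry_branching x :
  branching (cherry x) /\ next (cherry x) = single (TMerge HNone x x).
Proof. by []. Qed.

(** No child of the top node is a leaf, so only the vertical step acts: both paths of two edges
    contract and a level is lost. *)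
Lemma forked_single_branching x :
  branching (full 1 (single (TMerge HNone x x))) /\
  next (full 1 (single (TMerge HNone x x))) = cherry (grow x).
Proof. by []. Qed.

(** The right siblings are indexed by height, so that [spineSr] can split off the level that the
    second iteration of a pair removes. *)
Fixpoint spine (f : nat -> etree top) n t : etree top :=
  if n is n'.+1 then pair_node (e, spine f n' t) (e, f n') else t.

Lemma spineSr f n t :
  spine f n.+1 t = spine (f \o succn) n (pair_node (e, t) (e, f 0)).
Proof. by elim: n => //= n ->. Qed.

Lemma spine_branching f f' n t :
  branching t -> (forall k, branching (f k) /\ next (f k) = f' k) ->
  branching (spine f n t) /\ next (spine f n t) = spine f' n (next t).
Proof.
move=> bt bf; elim: n => [|n [IHb IHn]] //=; have [bfn <-] := bf n.
by have [-> ->] := @pair_branching e (spine f n t) e (f n) IHb bfn; rewrite IHn.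
Qed.

(* [W] is what is left of the star, or the single edge it has become; it hangs
   from the leftmost bottom node of a complete binary tree of height [n.+1]. *)
Definition gadget n x y W :=
  spine (fun k => full k (cherry x)) n (pair_node (y, W) (x, leaf)).

(* The gadget after the first iteration of each pair of iterations. *)
Definition gadget_mid n x y W :=
  spine (fun k => full k (single (TMerge HNone x x))) n
        (ENode [:: (TMerge HLeft y x, W)]).

Lemma spine_step n x y W W' :
  branching (pair_node (y, W) (x, leaf)) ->
  next (pair_node (y, W) (x, leaf)) = ENode [:: (TMerge HLeft y x, W')] ->
  branching (gadget n x y W) /\ next (gadget n x y W) = gadget_mid n x y W'.
Proof.
move=> bt nt; rewrite /gadget_mid -nt; apply: spine_branching => // k.
by rewrite -(proj2 (cherry_branching x)); apply: full_branching.
Qed.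

Lemma gadget_mid_step n x y W z W' :
  let t := pair_node (e, ENode [:: (TMerge HLeft y x, W)])
                     (e, single (TMerge HNone x x)) in
  branching t -> next t = pair_node (z, W') (grow x, leaf) ->
  branching (gadget_mid n.+1 x y W) /\
  next (gadget_mid n.+1 x y W) = gadget n (grow x) z W'.
Proof.
move=> t bt nt; rewrite /gadget_mid spineSr /gadget -nt.
apply: spine_branching => // k; rewrite [(_ \o _) k]fullSr.
rewrite -(proj2 (forked_single_branching x)).
exact: full_branching.
Qed.

Lemma gadget_branching_step n x y W : branching W ->
  branching (gadget n x y W) /\ next (gadget n x y W) = gadget_mid n x y (next W).
Proof.
move=> bW; have dW := down_branching bW.
have D : down (pair_node (y, W) (x, leaf)) =
         ([::], ENode [:: (TMerge HLeft y x, next W)]).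
  rewrite /down /= is_leaf_hstep (negPf (branching_nonleaf bW)) /=.
  rewrite /hmerge /= is_leaf_hstep (negPf (branching_nonleaf bW)) /=.
  by rewrite -/(down W) dW.
have [] := @branchingP (pair_node (y, W) (x, leaf)) _ isT D.
exact: spine_step.
Qed.

Lemma gadget_mid_branching_step n x y W : branching W ->
  branching (gadget_mid n.+1 x y W) /\ exists z,
  next (gadget_mid n.+1 x y W) = gadget n (grow x) z (next W).
Proof.
move=> bW; have dW := down_branching bW.
set t := pair_node (e, ENode [:: (TMerge HLeft y x, W)])
                   (e, single (TMerge HNone x x)).
(* A branching [W] cuts the path, which then has two edges and contracts wholly. *)
pose z := TMerge (if is_leaf (next W) then VNoBottom else VBottom) e
                 (TMerge HLeft y x).
have D : down t = ([::], pair_node (z, next W) (grow x, leaf)).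
  by rewrite down_nonleaf //= /down /= -/(down W) dW.
have [bt nt] := @branchingP t _ isT D.
have [b2 n2] := @gadget_mid_step n _ _ _ _ _ bt nt.
by split=> //; exists z.
Qed.

(** The horizontal merge marks the edge above [b], which blocks the vertical merge of these two
    edges. *)
Lemma gadget_single_step n x y b :
  branching (gadget n x y (single b)) /\
  next (gadget n x y (single b)) = gadget_mid n x y (single b).
Proof. exact: spine_step. Qed.

(** Now [b], [TMerge HLeft y x] and [e] form a path of three edges: the lower two merge and [e]
    stays, so [b] grows while a level is lost. *)
Lemma gadget_mid_single_step n x y b :
  branching (gadget_mid n.+1 x y (single b)) /\
  next (gadget_mid n.+1 x y (single b)) =
    gadget n (grow x) e (single (TMerge VNoBottom (TMerge HLeft y x) b)).
Proof. exact: gadget_mid_step. Qed.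

(** * Collapse of a star *)

Fixpoint pairup (s : seq top) : seq top :=
  if s is x :: y :: s' then TMerge HNone x y :: pairup s' else s.

Definition star (s : seq top) : etree top := ENode [seq (x, leaf) | x <- s].

(** A single unmarked edge would join the path from above; a single marked one, left by a star with
    two leaves, does not. *)
Lemma vdown_star (s : seq (bool * top)) : (forall x, s <> [:: (false, x)]) ->
  vdown (ENode [seq (c, ENode [::]) | c <- s]) = ([::], star (map snd s)).
Proof.
move=> ns; rewrite /star.
have E : flatten [seq (let: (s0, u) := vdown c.2 in
     kids (vpath (rcons s0 c.1, u))) | c <- [seq (c, ENode [::]) | c <- s]]
   = [seq (x, leaf) | x <- map snd s].
  by rewrite -!map_comp; elim: s {ns} => //= -[b x] s /= ->.
rewrite -E; case: s ns {E} => [|[[] x] [|y s]] // ns.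
by case: (ns x).
Qed.

Fixpoint mark_pairup (s : seq top) : seq (bool * top) :=
  if s is x :: y :: s' then (true, TMerge HNone x y) :: mark_pairup s'
  else map (pair false) s.

Lemma mark_pairupE s : map snd (mark_pairup s) = pairup s.
Proof.
have [n] := ubnP (size s); elim: n s => // n IH [|x [|y s]] //= sz.
by rewrite IH //; lia.
Qed.

Lemma hstep_star s :
  hstep (star s) = ENode [seq (c, ENode [::]) | c <- mark_pairup s].
Proof.
rewrite /star /= -map_comp; congr ENode.
have [n] := ubnP (size s); elim: n s => // n IH [|x [|y [|z [|u s]]]] //= sz.
by congr (_ :: _); apply: (IH [:: z, u & s]) => /=; lia.
Qed.

Lemma down_star s : 1 < size s -> down (star s) = ([::], star (pairup s)).
Proof.
move=> sz; rewrite /down hstep_star vdown_star ?mark_pairupE //.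
by case: s sz => [|x [|y s]].
Qed.

Lemma star_branching s : 1 < size s ->
  branching (star s) /\ next (star s) = star (pairup s).
Proof.
by move=> sz; apply: branchingP; [case: s sz | exact: down_star].
Qed.

Lemma iteration_star s : 1 < size s -> iteration (star s) = star (pairup s).
Proof. by move=> sz; rewrite /iteration /vstep -/(down _) down_star. Qed.

Lemma size_pairup s : size (pairup s) = uphalf (size s).
Proof.
have [n] := ubnP (size s); elim: n s => // n IH [|x [|y s]] //= sz.
by rewrite IH //; lia.
Qed.

(** * Evolution of a gadget *)

(* On a cluster containing a whole star, [word] returns the labels of the star
   leaves, and [depth] the number of [VNoBottom] merges made after the star
   became one cluster. *)
Fixpoint word (t : top) : seq A :=
  match t with
  | TLeaf _ c => [:: c]
  | TMerge VNoBottom _ r => word r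
  | TMerge _ l r => word l ++ word r
  end.

Fixpoint depth (t : top) : nat :=
  if t is TMerge VNoBottom _ r then (depth r).+1 else 0.

Lemma word_pairup s : flatten (map word (pairup s)) = flatten (map word s).
Proof.
have [n] := ubnP (size s); elim: n s => // n IH [|x [|y s]] //= sz.
by rewrite IH ?catA //; lia.
Qed.

(** The end [u] need not branch: it may be the path that remains of a gadget. *)
Definition reach k t u := all branching (traject next t k) /\ iter k next t = u.

Lemma reach1 t u : branching t /\ next t = u -> reach 1 t u.
Proof. by case=> bt nt; split=> //=; rewrite bt. Qed.

Lemma reach_trans k l t u v : reach k t u -> reach l u v -> reach (k + l) t v.
Proof.
case=> bt tu [bu uv]; split; last by rewrite addnC iterD tu.
by rewrite trajectD all_cat bt tu bu.
Qed.

(** Two iterations quarter the star and cost the gadget one level. *)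
Lemma reach_star p n x y s : size s = 4 ^ p ->
  exists x' y' b, word b = flatten (map word s) /\
    reach (p * 2) (gadget (p + n) x y (star s)) (gadget n x' y' (single b)).
Proof.
elim: p x y s => [|p IH] x y s sz.
  by case: s sz => [|b []] // _; exists x, y, b; rewrite /= cats0; do !split.
have gt4 : 0 < 4 ^ p by rewrite expn_gt0.
have [|b1 n1] := @star_branching s; first by rewrite sz expnS; lia.
have [|b2 n2] := @star_branching (pairup s).
  by rewrite size_pairup sz expnS; lia.
have /reach1 r1 := gadget_branching_step (p + n).+1 x y b1.
rewrite n1 in r1.
have [b3 [z n3]] := gadget_mid_branching_step (p + n) x y b2.
have /reach1 r2 := conj b3 n3.
rewrite n2 in r2.
have [|x' [y' [b [wb r3]]]] := IH (grow x) z (pairup (pairup s)).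
  by rewrite !size_pairup sz expnS; lia.
exists x', y', b; split; first by rewrite wb !word_pairup.
exact: (reach_trans r1 (reach_trans r2 r3)).
Qed.

(** Each pair of iterations adds one [VNoBottom] merge above the star cluster, which raises [depth]
    and keeps [word]. *)
Lemma reach_single p n x y b :
  exists x' y' b', [/\ word b' = word b, p <= depth b' &
    reach (p * 2) (gadget (p + n) x y (single b)) (gadget n x' y' (single b'))].
Proof.
suff [x' [y' [b' [? ? ?]]]] : exists x' y' b',
   [/\ word b' = word b, p + depth b <= depth b' &
    reach (p * 2) (gadget (p + n) x y (single b)) (gadget n x' y' (single b'))].
  by exists x', y', b'; split=> //; lia.
elim: p x y b => [|p IH] x y b; first by exists x, y, b; do !split.
have /reach1 r1 := gadget_single_step (p + n).+1 x y b.
have /reach1 r2 := gadget_mid_single_step (p + n) x y b.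
have [x' [y' [b' [wb db r3]]]] := IH (grow x) e (TMerge VNoBottom (TMerge HLeft y x) b).
exists x', y', b'; split; [exact: wb | by move: db => /=; lia|].
exact: (reach_trans r1 (reach_trans r2 r3)).
Qed.

(** Half of the [p + p] levels are lost while the star collapses, half while its cluster grows; one
    more iteration turns the last fork into a path. *)
Lemma reach_gadget p w : size w = 4 ^ p ->
  exists y b, [/\ word b = w, p <= depth b &
    reach (p * 2 + (p * 2 + 1))
      (gadget (p + p) e e (star [seq TLeaf a c | c <- w]))
      (ENode [:: (y, single b)])].
Proof.
move=> sz; have [|x [y [b [wb r1]]]] := @reach_star p p e e [seq TLeaf a c | c <- w].
  by rewrite size_map.
have [x' [y' [b' [wb' db' r2]]]] := reach_single p 0 x y b.
have /reach1 r3 := gadget_single_step 0 x' y' b'.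
exists (TMerge HLeft y' x'), b'; split=> //.
  by rewrite wb' wb -map_comp; elim: (w) => //= c s ->.
by rewrite addn0 in r2; exact: (reach_trans r1 (reach_trans r2 r3)).
Qed.

(** * Gadgets below a common root *)

Definition root ts : etree top := ENode [seq (e, t) | t <- ts].

Lemma iteration_root ts : 1 < size ts -> all (fun t => ~~ is_leaf t) ts ->
  iteration (root ts) = ENode (flatten [seq
    kids (vpath (rcons (down t).1 (false, e), (down t).2)) | t <- ts]).
Proof.
move=> sz nl; rewrite /iteration /vstep -/(down _) down_nonleaf ?size_map ?all_map //.
by rewrite -map_comp.
Qed.

Lemma iteration_root_branching ts : 1 < size ts -> all branching ts ->
  iteration (root ts) = root (map next ts).
Proof.
move=> sz bts; rewrite iteration_root //; last first.
  by apply: sub_all bts => t; apply: branching_nonleaf.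
congr ENode; elim: ts bts {sz} => //= t ts IH /andP[bt bts].
by rewrite down_branching //= IH.
Qed.

Lemma iter_root (W : Type) k (f g : W -> etree top) ws : 1 < size ws ->
  (forall w, reach k (f w) (g w)) ->
  iter k (@iteration A) (root (map f ws)) = root (map g ws).
Proof.
move=> sz; elim: k f => [|k IH] f fg.
  by congr root; apply: eq_map => w; case: (fg w).
rewrite iterSr iteration_root_branching ?size_map //; last first.
  by elim: (ws) => //= w s ->; case: (fg w) => /= /andP[->].
rewrite -map_comp IH // => w; case: (fg w) => /= /andP[_ bw].
by rewrite -iterS iterSr.
Qed.

(** With its root edge each gadget is a path of three edges; the first iteration merges the lower
    two, the second the rest. *)
Lemma iter_root_path (ybs : seq (top * top)) : 1 < size ybs ->
  iter 2 (@iteration A) (root [seq ENode [:: (yb.1, single yb.2)] | yb <- ybs]) =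
  star [seq TMerge VNoBottom e (TMerge VNoBottom yb.1 yb.2) | yb <- ybs].
Proof.
move=> sz; rewrite iterSr iteration_root ?size_map //; last by elim: (ybs).
rewrite -map_comp.
rewrite iterS [X in iteration X](_ : _ =
    root [seq single (TMerge VNoBottom yb.1 yb.2) | yb <- ybs]); last first.
  by congr ENode; elim: (ybs) => //= yb s ->.
rewrite iteration_root ?size_map //; last by elim: (ybs).
by congr ENode; elim: (ybs) => //= yb s ->.
Qed.

(** * The input trees of the gadgets *)

Fixpoint full_tree n : tree A :=
  if n is n'.+1 then Node a [:: full_tree n'; full_tree n'] else Node a [::].

Fixpoint gadget_tree w n : tree A :=
  if n is n'.+1 then Node a [:: gadget_tree w n'; full_tree n]
  else Node a [:: Node a [seq Node c [::] | c <- w]; Node a [::]].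

Lemma init_full_tree n : init (full_tree n.+1) = full n (cherry e).
Proof.
elim: n => // n IH; rewrite [LHS]/= -/(init (full_tree n.+1)).
by rewrite /= in IH *; rewrite IH.
Qed.

Lemma label_gadget_tree w n : label (gadget_tree w n) = a.
Proof. by case: n. Qed.

Lemma init_gadget_tree w n :
  init (gadget_tree w n) = gadget n e e (star [seq TLeaf a c | c <- w]).
Proof.
elim: n => [|n IH].
  by rewrite /gadget /star /= -!map_comp.
have := init_full_tree n; rewrite /gadget /= -/(gadget _ _ _ _) -IH => <-.
by rewrite label_gadget_tree.
Qed.

Lemma nodes_full_tree n : (nodes (full_tree n)).+1 = 2 ^ n.+1.
Proof. by elim: n => //= n IH; rewrite expnS -IH; lia. Qed.

Lemma nodes_gadget_tree w n : (nodes (gadget_tree w n)).+1 = size w + 2 ^ n.+2.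
Proof.
elim: n => [|n IH].
  rewrite /= -map_comp (_ : sumn _ = size w) ?addn0; first by lia.
  by elim: w => //= c w ->.
have := nodes_full_tree n.+1.
by rewrite /= addn0 in IH * => h; rewrite [2 ^ n.+3]expnS; lia.
Qed.

End Construction.

(** * Counting clusters *)

Section Counting.
Variable A : eqType.
Local Notation top := (top_tree A).
Implicit Types (t c : top) (s : seq top).

Lemma subset_subtrees_pairup s :
  {subset flatten (map (@subtrees A) s) <= flatten (map (@subtrees A) (pairup s))}.
Proof.
have [n] := ubnP (size s); elim: n s => // n IH [|x [|y s]] //= sz t; first by [].
rewrite inE !mem_cat => /or3P[->|->|/IH ->]; rewrite ?orbT //.
by move: sz => /=; lia.
Qed.

Lemma iter_star s : 0 < size s -> exists k c,
  iter k (@iteration A) (star s) = single c /\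
  {subset flatten (map (@subtrees A) s) <= subtrees c}.
Proof.
have [n] := ubnP (size s); elim: n s => // n IH s sz s0.
have [s1|s1] := ltnP 1 (size s); last first.
  case: s s0 s1 {sz} => [|c []] // _ _; exists 0, c; split=> // t.
  by rewrite /= cats0.
have [||k [c [kc sub]]] := IH (pairup s); rewrite ?size_pairup; [lia..|].
exists k.+1, c; split; first by rewrite iterSr iteration_star.
by move=> t /subset_subtrees_pairup /sub.
Qed.

(** Stripping the outer [VNoBottom] merges one at a time lowers [depth] by one and keeps [word]. *)
Lemma depth_subtrees i t : i <= depth t ->
  exists2 u, u \in subtrees t & depth u = i /\ word u = word t.
Proof.
elim: t => [x y|m l _ r IH] /=.
  by rewrite leqn0 => /eqP->; exists (TLeaf x y); rewrite ?inE.
case: m; try by rewrite leqn0 => /eqP->; eexists; [exact: mem_head|].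
rewrite leq_eqVlt => /predU1P[->|]; first by eexists; [exact: mem_head|].
by rewrite ltnS => /IH[u ur [<- <-]]; exists u; rewrite // inE mem_cat ur !orbT.
Qed.

Lemma choose_pairs (W : eqType) (B : Type) (f : W -> B) (g : top * top -> B)
    (P : W -> top * top -> Prop) (ws : seq W) :
  (forall w, exists yb, f w = g yb /\ P w yb) ->
  exists2 ybs, map f ws = map g ybs &
    forall w, w \in ws -> exists2 yb, yb \in ybs & P w yb.
Proof.
move=> fg; elim: ws => [|w ws [ybs E sub]]; first by exists [::].
have [yb [fw Pw]] := fg w; exists (yb :: ybs); first by rewrite /= fw E.
move=> v; rewrite inE => /predU1P[->|/sub[zc zcs Pv]].
  by exists yb; rewrite // mem_head.
by exists zc; rewrite // inE zcs orbT.
Qed.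

Lemma size_le_top_dag (W : eqType) p (f : W -> seq A) (ws : seq W) c :
  injective f -> uniq ws ->
  (forall w i, w \in ws -> i <= p ->
     exists2 u, u \in subtrees c & depth u = i /\ word u = f w) ->
  p.+1 * size ws <= top_dag_size c.
Proof.
move=> f_inj uws sub.
(* Distinct keys force distinct subtrees, and at least [p.+1 * size ws] keys occur. *)
pose key t := (depth t, word t).
rewrite -[p.+1](size_iota 0) -(size_allpairs (fun i w => (i, f w))).
rewrite /top_dag_size -(size_map key); apply: uniq_leq_size.
  apply: allpairs_uniq => //; first exact: iota_uniq.
  by move=> [i v] [j w] _ _ [-> /f_inj ->].
move=> _ /allpairsP[[i w] [ilp wws ->]].
have [|u uc [<- <-]] := sub w i wws; first by move: ilp; rewrite mem_iota ltnS.
by apply: (map_f key); rewrite mem_undup.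
Qed.

End Counting.

(** * The lower bound *)

Section HardTree.
Variables (Sigma : finType) (a : Sigma).

Definition hard_tree p : tree Sigma :=
  Node a [seq gadget_tree a (tval w) (p + p) | w <- enum {: (4 ^ p).-tuple Sigma}].

Lemma size_words m : size (enum {: m.-tuple Sigma}) = #|Sigma| ^ m.
Proof. by rewrite -cardE card_tuple. Qed.

(** Each gadget has [5 * 4 ^ p - 1] nodes; the subtracted units stand on the left to avoid truncated
    subtraction. *)
Lemma nodes_hard_tree p :
  nodes (hard_tree p) + #|Sigma| ^ (4 ^ p) = 5 * 4 ^ p * #|Sigma| ^ (4 ^ p) + 1.
Proof.
rewrite -size_words /= -map_comp; elim: (enum _) => [|w ws] /=; first by lia.
have := nodes_gadget_tree a (tval w) (p + p).
have -> : 2 ^ (p + p).+2 = 4 * 4 ^ p.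
  by rewrite -[4]/(2 ^ 2) -expnM -expnD; congr (2 ^ _); lia.
by rewrite size_tuple; lia.
Qed.

Lemma top_tree_of_hard_tree p : 1 < #|Sigma| -> exists c,
  top_tree_of (hard_tree p) c /\ p.+1 * #|Sigma| ^ (4 ^ p) <= top_dag_size c.
Proof.
move=> gt1; set ws := enum {: (4 ^ p).-tuple Sigma}.
have sz : 1 < size ws.
  by rewrite size_words -{1}(exp1n (4 ^ p)) ltn_exp2r // expn_gt0.
pose k := p * 2 + (p * 2 + 1).
pose f (w : (4 ^ p).-tuple Sigma) := init (gadget_tree a (tval w) (p + p)).
pose g (yb : top_tree Sigma * top_tree Sigma) := ENode [:: (yb.1, single yb.2)].
have initT : init (hard_tree p) = root a (map f ws).
  rewrite /root /f /= -!map_comp; congr ENode; apply: eq_map => w /=.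
  by rewrite label_gadget_tree.
have fg w : exists yb, iter k (@next Sigma) (f w) = g yb /\
    (word yb.2 = w /\ p <= depth yb.2 /\ reach k (f w) (g yb)).
  have [y [b [wb db r]]] := reach_gadget a (size_tuple w).
  by exists (y, b); rewrite /f init_gadget_tree; case: (r).
have [ybs E sub] := choose_pairs ws fg.
have szy : 1 < size ybs by rewrite -(size_map g) -E size_map.
have it1 : iter k (@iteration Sigma) (root a (map f ws)) = root a (map g ybs).
  rewrite -E; apply: iter_root => // w.
  by have [yb [-> [_ [_ r]]]] := fg w.
pose cs := [seq TMerge VNoBottom (TLeaf a a) (TMerge VNoBottom yb.1 yb.2) | yb <- ybs].
have [|l [c [lc subc]]] := @iter_star Sigma cs; first by rewrite size_map ltnW.
exists c; split.
  by exists (l + (2 + k)); rewrite initT (iterD l) (iterD 2) it1 iter_root_path.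
rewrite -size_words -/ws.
apply: (@size_le_top_dag Sigma _ p (@tval (4 ^ p) Sigma)).
- exact: val_inj.
- exact: enum_uniq.
move=> w i /sub[yb ybin [wb [db _]]] ip.
pose t := TMerge VNoBottom (TLeaf a a) (TMerge VNoBottom yb.1 yb.2).
(* The two merges along the final path are of type [VNoBottom] too, so [depth t] is at least [p]. *)
have [|u ut [du wu]] := @depth_subtrees Sigma i t; first by rewrite /=; lia.
exists u; last by rewrite du wu -wb.
by apply: subc; apply/flatten_mapP; exists t => //; apply: map_f.
Qed.

End HardTree.

Local Open Scope ring_scope.

(** From [n <= 5 * m * K] and [m <= logn] the quotient is at most [5 * K]; the iterated logarithm is
    at most [2 * p + 2]. Their product [10 * p.+1 * K] dictates the constant. *)
Lemma hard_tree_bound (R : realType) (sigma p n : nat) :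
  (1 < sigma)%N ->
  (n + sigma ^ (4 ^ p) = 5 * 4 ^ p * sigma ^ (4 ^ p) + 1)%N ->
  10^-1 * (n%:R / log_base sigma%:R n%:R * log_base 2 (log_base sigma%:R n%:R))
    <= (p.+1 * sigma ^ (4 ^ p))%:R :> R.
Proof.
set m := (4 ^ p)%N; set K := (sigma ^ m)%N => gt1 nE.
have m0 : (0 < m)%N by rewrite expn_gt0.
have K0 : (0 < K)%N by rewrite expn_gt0; lia.
have nle : (n <= 5 * m * K)%N by lia.
have nge : (K <= n)%N by nia.
have n0 : (0 < n)%N by lia.
have lns : 0 < ln sigma%:R :> R by rewrite ln_gt0 // ltr1n.
have ln2 : 0 < ln 2 :> R by rewrite ln_gt0 // ltr1n.
have log_le (b x k : nat) : 0 < ln b%:R :> R -> (0 < b)%N -> (0 < x)%N ->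
    (x <= b ^ k)%N -> log_base b%:R x%:R <= k%:R :> R.
  move=> lb b0 x0 xk; rewrite /log_base ler_pdivrMr // mulr_natl -lnXn ?ltr0n //.
  by rewrite ler_ln ?posrE -?natrX ?ltr0n ?ler_nat ?expn_gt0 ?b0.
set logn := log_base sigma%:R n%:R.
have lognge : m%:R <= logn.
  rewrite /logn /log_base ler_pdivlMr // mulr_natl -lnXn ?ltr0n; last by lia.
  by rewrite ler_ln ?posrE -?natrX ?ltr0n ?ler_nat.
have p2 : (2 * p + 3 <= 3 * m)%N.
  by rewrite /m; elim: (p) => // q IH; rewrite expnS; lia.
have lognle : logn <= (2 ^ (2 * p + 2))%N%:R.
  (* Here [5 * m <= 2 ^ (2 * p + 3)], hence [n <= sigma ^ (m + (2 * p + 3))], and by [p2] this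
     exponent is at most [4 * m]. *)
  apply: (@le_trans _ _ (m + (2 * p + 3))%:R); last first.
    by rewrite ler_nat expnD expnM -/m; lia.
  apply: log_le => //; first by lia.
  rewrite expnD -/K (leq_trans nle) // mulnC leq_mul2l; apply/orP; right.
  apply: (@leq_trans (2 ^ (2 * p + 3))); last by rewrite leq_exp2r //; lia.
  by rewrite expnD expnM -/m; lia.
have m1 : 1 <= m%:R :> R by rewrite ler1n.
have logn0 : 0 < logn by lra.
have loglog : log_base 2 logn <= (2 * p + 2)%:R.
  rewrite /log_base ler_pdivrMr // mulr_natl -lnXn ?ltr0n //.
  by rewrite ler_ln ?posrE -?natrX ?ltr0n ?expn_gt0.
have loglog0 : 0 <= log_base 2 logn.
  by rewrite /log_base divr_ge0 ?ln_ge0 //; lra.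
have quot : n%:R / logn <= (5 * K)%:R.
  rewrite ler_pdivrMr //; apply: (@le_trans _ _ ((5 * K)%:R * m%:R)).
    by rewrite -natrM ler_nat; lia.
  by rewrite ler_wpM2l.
have quot0 : 0 <= n%:R / logn by rewrite divr_ge0 // ltW.
rewrite mulrC ler_pdivrMr //; apply: (le_trans (ler_pM quot0 loglog0 quot loglog)).
by rewrite -!natrM ler_nat; lia.
Qed.

Theorem theorem1 (R : realType) :
  exists C : R, 0 < C /\
  forall (sigma : nat) (Sigma : finType),
    (2 <= sigma)%N -> #|Sigma| = sigma ->
    exists F : nat -> tree Sigma,
      (forall N : nat, exists i : nat, (N <= nodes (F i))%N) /\
      forall i : nat,
        let n : R := (nodes (F i))%:R in
        let logn : R := log_base sigma%:R n in
        exists c : top_tree Sigma,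
          top_tree_of (F i) c /\
          C * (n / logn * log_base 2 logn) <= (top_dag_size c)%:R.
Proof.
exists 10^-1; split; first by rewrite invr_gt0.
move=> sigma Sigma gt1 cardS.
have /card_gt0P[a _] : (0 < #|Sigma|)%N by rewrite cardS; lia.
have nE p := nodes_hard_tree a p; rewrite cardS in nE.
exists (hard_tree a); split.
  move=> N; exists N; have := nE N.
  have := ltn_expl N (isT : 1 < 4)%N.
  have : (0 < sigma ^ 4 ^ N)%N by rewrite expn_gt0; lia.
  nia.
move=> p n logn.
have [|c [Tc cle]] := top_tree_of_hard_tree a p; first by rewrite cardS.
exists c; split=> //.
apply: (le_trans (hard_tree_bound R gt1 (nE p))).
by rewrite ler_nat -cardS.
Qed.
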